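(* Let $f=(A,B,C)$ be a partially reduced imaginary or unusual binary quadratic form over $\mathbb{F}_q[t]$ and suppose $f=f\circ M$ for some $M\in GL_2(\mathbb{F}_q[t])$. If $|A|<|C|$, then $M=\pm I$, or $M=\pm J$ with $J=\begin{pmatrix}1&0\\0&-1\end{pmatrix}$, the latter only if $B=0$. If $|A|=|C|$, then $M=\begin{pmatrix}\alpha&\beta\\ -u\lambda\beta& u\alpha\end{pmatrix}$ with $\alpha,\beta\in\mathbb{F}_q$, $\lambda=-4/h$ and $u=\det M=\pm1$. Moreover, if $\beta\ne0$ then $B\neq0$ and $\alpha=u\beta(C\lambda-A)/B\in\mathbb{F}_q$. Consequently such automorphisms with $\beta\neq 0$ exist if and only if $((C\lambda-A)/B)^2+\lambda$ is a square in $\mathbb{F}_q^*$ (with $(C\lambda-A)/B\in\mathbb{F}_q$), in which case there are exactly two of them.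
   Context: $\mathbb{F}_q$ is a finite field with $\gcd(q,6)=1$; $|H|=q^{\deg H}$ for nonzero $H\in\mathbb{F}_q[t]$, $|0|=0$, $\mathrm{sgn}(H)$ = leading coefficient. A binary quadratic form $f=(A,B,C)$ is $Ax^2+Bxy+Cy^2$ over $\mathbb{F}_q[t]$ with discriminant $D=B^2-4AC$; $(f\circ M)(x,y)=f(\alpha x+\beta y,\gamma x+\delta y)$; $GL_2(\mathbb{F}_q[t])$ = matrices over $\mathbb{F}_q[t]$ with determinant in $\mathbb{F}_q^*$. $D$ is imaginary if $\deg D$ odd, unusual if $\deg D$ even and $\mathrm{sgn}(D)$ a non-square in $\mathbb{F}_q^*$. Fix a primitive root $h$ of $\mathbb{F}_q^*$, $S=\{h^i:0\le i\le (q-3)/2\}$. Standing assumptions: forms are primitive, irreducible, $D\notin\mathbb{F}_q$, $\mathrm{sgn}(D)\in\{1,h\}$. A form $(A,B,C)$ is partially reduced if $|B|<|A|\le|C|$; if $|A|<|C|$ then $\mathrm{sgn}(A)\in\{1,h\}$, if $|A|=|C|$ then $\mathrm{sgn}(A)=1$; and $B\ne0$ implies $\mathrm{sgn}(B)\in S$. *)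

(* Defs.v *)
From HB Require Import structures.
From mathcomp Require Import all_boot all_order all_algebra all_field.
Set Implicit Arguments. Unset Strict Implicit. Unset Printing Implicit Defensive.
Import Order.TTheory GRing.Theory Num.Theory.
Local Open Scope ring_scope.

Section QF.
Variable F : finFieldType.
Local Notation P := {poly F}.

(* |H| = q^deg H, |0| = 0: comparisons of |.| are comparisons of [size]. *)

Definition mx2 (R : Type) (a b c d : R) : 'M[R]_2 :=
  \matrix_(i < 2, j < 2)
    if (i == 0 :> nat) then (if (j == 0 :> nat) then a else b)
    else (if (j == 0 :> nat) then c else d).

Definition mx_beta (R : Type) (M : 'M[R]_2) : R := M ord0 ord_max.

Definition disc (A B C : P) : P := B ^+ 2 - 4%:R * A * C.

(* f o M for f = (A,B,C), M = [[al, be], [ga, de]]: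
   f(al x + be y, ga x + de y) *)
Definition fcomp (A B C : P) (M : 'M[P]_2) : P * P * P :=
  let al := M ord0 ord0 in let be := M ord0 ord_max in
  let ga := M ord_max ord0 in let de := M ord_max ord_max in
  (A * al ^+ 2 + B * al * ga + C * ga ^+ 2,
   2%:R * A * al * be + B * (al * de + be * ga) + 2%:R * C * ga * de,
   A * be ^+ 2 + B * be * de + C * de ^+ 2).

Definition inGL2 (M : 'M[P]_2) : Prop := \det M \is a GRing.unit.

Definition isAut (A B C : P) (M : 'M[P]_2) : Prop :=
  inGL2 M /\ fcomp A B C M = (A, B, C).

Definition primitive_form (A B C : P) : Prop := coprimep (gcdp A B) C.

(* irreducible: does not factor as a product of two linear forms *)
Definition irreducible_form (A B C : P) : Prop :=
  ~ exists a b c d : P, [/\ A = a * c, B = a * d + b * c & C = b * d].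

Definition is_square_nz (x : F) : Prop := exists y : F, y != 0 /\ x = y ^+ 2.

Definition primitive_root (h : F) : Prop :=
  h != 0 /\ forall x : F, x != 0 -> exists i : nat, x = h ^+ i.

Definition Sset (h : F) (x : F) : Prop :=
  exists i : nat, (i <= (#|F| - 3) %/ 2)%N /\ x = h ^+ i.

Definition imaginary (D : P) : Prop := odd (size D).-1.
Definition unusual (D : P) : Prop :=
  ~~ odd (size D).-1 /\ ~ is_square_nz (lead_coef D).

Definition standing (h : F) (A B C : P) : Prop :=
  [/\ primitive_form A B C, irreducible_form A B C,
      (1 < size (disc A B C))%N &
      (lead_coef (disc A B C) = 1 \/ lead_coef (disc A B C) = h)].

Definition partially_reduced (h : F) (A B C : P) : Prop :=
  [/\ (size B < size A)%N, (size A <= size C)%N,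
      ((size A < size C)%N -> lead_coef A = 1 \/ lead_coef A = h),
      (size A = size C -> lead_coef A = 1) &
      (B != 0 -> Sset h (lead_coef B))].

End QF.

(* Main.v *)
(* Because [D] is imaginary or unusual, the leading terms of [A x^2] and [C y^2]
   cannot cancel, and [|B| < |A| <= |C|] makes [B x y] negligible; hence
   [|f(x, y)| = max (|A x^2|, |C y^2|)]. Applied to the columns of an
   automorphism [M], this bounds the degrees of its entries, and comparing
   discriminants gives [det M = 1] or [-1]. When [|A| < |C|] the matrix is upper
   triangular and the middle coefficient finishes the proof. When [|A| = |C|]
   all entries are constants, and the leading coefficients of [f o M = f] say
   that [M] is an isometry of [x^2 + y^2 / lam], which determines the second row
   of [M]; the full equations [M^T G M = G], with [G] the Gram matrix of [f],
   then give the relation between [C lam - A] and [B]. *)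
Require Import Defs.
From HB Require Import structures.
From mathcomp Require Import all_boot all_order all_algebra all_field.
From mathcomp Require Import fingroup cyclic ring zify.
Import Order.TTheory GRing.Theory Num.Theory.
Local Open Scope ring_scope.

(** By Lagrange in the additive group, [#|F|] times 1 is 0; as [#|F|] is odd, 2 = 0 would give 1 =
    0. *)
Lemma natr2_neq0_of_coprime (F : finFieldType) :
  coprime #|F| 6 -> (2%:R : F) != 0.
Proof.
move=> co; apply/eqP => two0.
have card0 : (#|F|%:R : F) = 0.
  have := @expg_cardG F [set: F]%G (1%R : F) (in_setT _).
  by rewrite FinRing.zmodXgE cardsT.
have odd_card : odd #|F|.
  by move: co; rewrite (coprimeMr _ 2 3) coprimen2 => /andP[].
move: card0; rewrite -(odd_double_half #|F|) odd_card -muln2 natrD natrM two0.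
by rewrite mulr0 addr0 => /eqP; rewrite oner_eq0.
Qed.

Lemma eq_opp0 (F : fieldType) (x : F) : (2%:R : F) != 0 -> x = - x -> x = 0.
Proof.
move=> two0 xN; apply: (mulfI two0); rewrite mulr0 -(subrr x) {3}xN; ring.
Qed.

(** * Two-by-two matrices by entries *)

Section Mx2.
Set Implicit Arguments. Unset Strict Implicit.

Lemma mx2_eta (R : Type) (M : 'M[R]_2) :
  M = mx2 (M ord0 ord0) (M ord0 ord_max) (M ord_max ord0) (M ord_max ord_max).
Proof.
apply/matrixP => i j; rewrite mxE.
by case: i j => [[|[|i]] ip] [[|[|j]] jp] //=; congr (M _ _); apply: val_inj.
Qed.

Lemma mx2_1 (R : nzRingType) : 1%:M = mx2 (1 : R) 0 0 1.
Proof. by rewrite [LHS]mx2_eta !mxE. Qed.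

Lemma opp_mx2 (R : nzRingType) (a b c d : R) :
  - mx2 a b c d = mx2 (- a) (- b) (- c) (- d).
Proof. by rewrite [LHS]mx2_eta !mxE. Qed.

Lemma det_mx2 (R : comNzRingType) (a b c d : R) :
  \det (mx2 a b c d) = a * d - b * c.
Proof.
rewrite (expand_det_row _ ord0) !big_ord_recl big_ord0 /cofactor !det_mx11 !mxE /=.
rewrite /bump /=; ring.
Qed.

End Mx2.

(** * Discriminants, sizes of the values of a form, entries of automorphisms *)

Section Forms.
Set Implicit Arguments. Unset Strict Implicit.
Variable F : finFieldType.
Hypothesis two_neq0 : (2%:R : F) != 0.
Implicit Types (A B C x y : {poly F}).

Lemma isAut_mx2 A B C (a b c d : {poly F}) :
  isAut A B C (mx2 a b c d) <->
  [/\ a * d - b * c \is a GRing.unit,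
      A * a ^+ 2 + B * a * c + C * c ^+ 2 = A,
      2%:R * A * a * b + B * (a * d + b * c) + 2%:R * C * c * d = B &
      A * b ^+ 2 + B * b * d + C * d ^+ 2 = C].
Proof.
rewrite /isAut /inGL2 /fcomp det_mx2 !mxE /=.
by split=> [[? [? ? ?]]|[? -> -> ->]].
Qed.

(** The discriminant is minus the determinant of twice the Gram matrix, and composition acts on Gram
    matrices by congruence. *)
Lemma disc_fcomp A B C (a b c d : {poly F}) :
  disc (A * a ^+ 2 + B * a * c + C * c ^+ 2)
       (2%:R * A * a * b + B * (a * d + b * c) + 2%:R * C * c * d)
       (A * b ^+ 2 + B * b * d + C * d ^+ 2)
  = (a * d - b * c) ^+ 2 * disc A B C.
Proof. rewrite /disc; ring. Qed.

Lemma four_neq0 : (4%:R : F) != 0.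
Proof. by rewrite (natrM _ 2 2) mulf_neq0. Qed.

(* [size_polyMleq] with [size] elaborated along the same structure path as in
   the other lemmas: [lia] compares atoms syntactically. *)
Lemma size_polyM_leq x y : (size (x * y)%R <= (size x + size y).-1)%N.
Proof. exact: size_polyMleq. Qed.

Lemma size_mul_sqr x y : x != 0 -> y != 0 ->
  size (x * y ^+ 2) = (size x + size y + size y - 2)%N.
Proof.
move=> x0 y0; rewrite size_mul ?expf_neq0 // expr2 size_mul //.
move: x0 y0; rewrite -!size_poly_gt0; move: (size x) (size y) => m n; lia.
Qed.

Lemma size_lead_disc A B C : (size B < size A)%N -> (size A <= size C)%N ->
  size (disc A B C) = (size A + size C).-1 /\
  lead_coef (disc A B C) = - (4%:R * lead_coef A * lead_coef C).
Proof.
move=> sBA sAC.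
have A0 : A != 0 by rewrite -size_poly_gt0; lia.
have C0 : C != 0 by rewrite -size_poly_gt0; lia.
have sAC4 : size (- (4%:R * A * C)) = (size A + size C).-1.
  rewrite size_polyN -mulrA -polyC_natr mul_polyC size_scale ?four_neq0 //.
  by rewrite size_mul.
have sB2 : (size (B ^+ 2)%R < size (- (4%:R * A * C)))%N.
  have := size_polyMleq B B; rewrite -expr2 sAC4; lia.
rewrite /disc addrC size_polyDl // lead_coefDl // lead_coefN !lead_coefM.
by rewrite sAC4 -polyC_natr lead_coefC.
Qed.

(** The obstruction to cancelling leading terms. Since deg D is [size A + size C - 2], it has the
    parity of [size A + size C]. *)
Lemma disc_anisotropic A B C :
  (size B < size A)%N -> (size A <= size C)%N ->
  imaginary (disc A B C) \/ unusual (disc A B C) ->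
  odd (size A + size C) \/
  ~ is_square_nz (- (4%:R * lead_coef A * lead_coef C)).
Proof.
move=> sBA sAC; have [sD lD] := size_lead_disc sBA sAC.
rewrite /imaginary /unusual lD sD => -[oD|[_ ?]]; [left|by right].
by move: oD; lia.
Qed.

Lemma size_form_value A B C x y :
  (size B < size A)%N -> (size A <= size C)%N ->
  imaginary (disc A B C) \/ unusual (disc A B C) ->
  (size (A * x ^+ 2)%R <= size (A * x ^+ 2 + B * x * y + C * y ^+ 2)%R)%N /\
  (size (C * y ^+ 2)%R <= size (A * x ^+ 2 + B * x * y + C * y ^+ 2)%R)%N.
Proof.
move=> sBA sAC /(disc_anisotropic sBA sAC) anis.
have A0 : A != 0 by rewrite -size_poly_gt0; lia.
have C0 : C != 0 by rewrite -size_poly_gt0; lia.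
have [->|x0] := eqVneq x 0.
  by rewrite !(expr2, mulr0, mul0r, add0r, size_poly0).
have [->|y0] := eqVneq y 0.
  by rewrite !(expr2, mulr0, mul0r, addr0, size_poly0).
have [sx sy] : (0 < size x)%N /\ (0 < size y)%N by rewrite !size_poly_gt0.
have sAx := size_mul_sqr A0 x0; have sCy := size_mul_sqr C0 y0.
have sBxy : (size (B * x * y)%R <= size B + size x + size y - 2)%N.
  have := size_polyM_leq (B * x) y; have := size_polyM_leq B x; lia.
(* From |B|^2 < |A||C|, |Bxy| lies below the geometric mean of |Ax^2| and |Cy^2|, hence below the
   larger of the two. *)
have [lt_xy|lt_yx|eq_xy] := ltngtP (size (A * x ^+ 2)) (size (C * y ^+ 2)).
- rewrite addrC size_polyDl; first by lia.
  apply: leq_ltn_trans (size_polyD _ _) _; rewrite gtn_max lt_xy.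
  by apply: leq_ltn_trans sBxy _; rewrite sCy; lia.
- rewrite -addrA size_polyDl; first by lia.
  apply: leq_ltn_trans (size_polyD _ _) _; rewrite gtn_max lt_yx andbT.
  by apply: leq_ltn_trans sBxy _; rewrite sAx; lia.
suff : (A * x ^+ 2 + B * x * y + C * y ^+ 2)`_((size (A * x ^+ 2)).-1) != 0.
  move=> nz; have : ((size (A * x ^+ 2)%R).-1
      < size (A * x ^+ 2 + B * x * y + C * y ^+ 2)%R)%N.
    by rewrite ltnNge; apply: contra nz => le; rewrite nth_default.
  by lia.
have coefAx : (A * x ^+ 2)`_((size (A * x ^+ 2)).-1) =
    lead_coef A * lead_coef x ^+ 2.
  by rewrite -[LHS]/(lead_coef _) lead_coefM lead_coef_exp.
have coefCy : (C * y ^+ 2)`_((size (A * x ^+ 2)).-1) =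
    lead_coef C * lead_coef y ^+ 2.
  by rewrite eq_xy -[LHS]/(lead_coef _) lead_coefM lead_coef_exp.
rewrite !coefD coefAx coefCy [(B * x * y)`_ _]nth_default; last first.
  by apply: leq_trans sBxy _; rewrite sAx; lia.
rewrite addr0; apply/eqP => isotropic.
have lx0 : lead_coef x != 0 by rewrite lead_coef_eq0.
have ly0 : lead_coef y != 0 by rewrite lead_coef_eq0.
have lA0 : lead_coef A != 0 by rewrite lead_coef_eq0.
case: anis => [|[]]; first by lia.
(* Equal sizes exclude odd [size A + size C]. Multiplying lc(C) lc(y)^2 = - lc(A) lc(x)^2 by -4
   lc(A) / lc(y)^2 gives this square root. *)
exists (2%:R * lead_coef A * lead_coef x / lead_coef y); split.
  by rewrite !mulf_neq0 ?invr_eq0.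
have -> : lead_coef C = - lead_coef A * lead_coef x ^+ 2 / lead_coef y ^+ 2.
  apply: (mulIf (expf_neq0 2 ly0)); rewrite divfK ?expf_neq0 //.
  apply/eqP; rewrite -subr_eq0; apply/eqP; rewrite -[RHS]isotropic; ring.
by field.
Qed.

Lemma size_factor_sqr_le1 x y : x != 0 ->
  (size (x * y ^+ 2)%R <= size x)%N -> (size y <= 1)%N.
Proof.
move=> x0; have [->|y0] := eqVneq y 0; first by rewrite size_poly0.
by rewrite size_mul_sqr //; move: x0 y0; rewrite -!size_poly_gt0; lia.
Qed.

(** The form takes the values A and C at the columns (a, c) and (b, d). The bounds on c and b stay
    unsimplified because their use depends on whether |A| < |C|. *)
Lemma isAut_entries_size A B C (a b c d : {poly F}) :
  (size B < size A)%N -> (size A <= size C)%N ->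
  imaginary (disc A B C) \/ unusual (disc A B C) ->
  isAut A B C (mx2 a b c d) ->
  [/\ (size a <= 1)%N, (size d <= 1)%N,
      (size (C * c ^+ 2)%R <= size A)%N & (size (A * b ^+ 2)%R <= size C)%N].
Proof.
move=> sBA sAC anis /isAut_mx2[_ eA _ eC].
have A0 : A != 0 by rewrite -size_poly_gt0; lia.
have C0 : C != 0 by rewrite -size_poly_gt0; lia.
have := size_form_value a c sBA sAC anis; rewrite eA => -[sa sc].
have := size_form_value b d sBA sAC anis; rewrite eC => -[sb sd].
by split => //; [apply: size_factor_sqr_le1 sa|apply: size_factor_sqr_le1 sd].
Qed.

Lemma isAut_det A B C (a b c d : {poly F}) :
  disc A B C != 0 -> isAut A B C (mx2 a b c d) ->
  a * d - b * c = 1 \/ a * d - b * c = -1.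
Proof.
move=> D0 /isAut_mx2[_ eA eB eC]; have := disc_fcomp A B C a b c d.
rewrite eA eB eC -{1}[disc A B C]mul1r => /(mulIf D0)/esym/eqP.
by rewrite sqrf_eq1 => /orP[]/eqP; [left|right].
Qed.

(** * Automorphisms when |A| < |C| *)

Lemma isAut_lt A B C (M : 'M[{poly F}]_2) :
  (size B < size A)%N -> (size A < size C)%N ->
  imaginary (disc A B C) \/ unusual (disc A B C) ->
  isAut A B C M ->
  M = 1%:M \/ M = - 1%:M \/
  ((M = mx2 1 0 0 (-1) \/ M = - mx2 1 0 0 (-1)) /\ B = 0).
Proof.
move=> sBA sAC anis; rewrite (mx2_eta M).
move: (M ord0 ord0) (M ord0 ord_max) (M ord_max ord0) (M ord_max ord_max).
move=> a b c d autM.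
have A0 : A != 0 by rewrite -size_poly_gt0; lia.
have C0 : C != 0 by rewrite -size_poly_gt0; lia.
have [_ _ sc _] := isAut_entries_size sBA (ltnW sAC) anis autM.
have c0 : c = 0.
  apply/eqP; apply: contraTT sc => c0; rewrite size_mul_sqr //.
  by move: c0; rewrite -size_poly_gt0; lia.
have D0 : disc A B C != 0.
  rewrite -size_poly_gt0; case: (size_lead_disc sBA (ltnW sAC)) => -> _; lia.
have := isAut_det D0 autM; case/isAut_mx2: autM => _ + + _.
rewrite c0 !(mulr0, expr0n, addr0, subr0, mul0r) => eA eB det1.
have two0 : (2%:R : {poly F}) != 0 by rewrite -polyC_natr polyC_eq0.
have a2 : a = 1 \/ a = -1.
  have : a ^+ 2 == 1 by apply/eqP/(mulfI A0); rewrite eA mulr1.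
  by rewrite sqrf_eq1 => /orP[]/eqP; [left|right].
have dE : d = a * (a * d).
  by case: a2 => ->; rewrite ?mulN1r ?mul1r ?opprK.
(* The middle coefficient reads 2Aab + B ad = B. For ad = 1 it gives b = 0; for ad = -1 it gives B =
   Aab, and |B| < |A| again forces b = 0, hence B = 0. *)
case: det1 => ad; rewrite ad in eB dE.
  have b0 : b = 0.
    have : 2%:R * A * a * b = 0.
      by rewrite -[RHS](subrr B) -{1}eB; ring.
    move/eqP; rewrite !mulf_eq0 (negPf A0) (negPf two0) /=.
    by case: a2 => ->; rewrite ?oppr_eq0 oner_eq0 => /eqP.
  by rewrite b0 dE mulr1; case: a2 => ->; [left|right; left];
    rewrite mx2_1 ?opp_mx2 ?oppr0.
have BE : B = A * (a * b).
  apply: (mulfI two0); apply/eqP; rewrite -subr_eq0; apply/eqP.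
  by rewrite -[RHS](subrr B) -{3}eB; ring.
have b0 : b = 0.
  apply/eqP; apply: contraTT sBA => b0; rewrite -leqNgt BE.
  have ab0 : a * b != 0.
    by rewrite mulf_neq0 //; case: a2 => ->; rewrite ?oppr_eq0 oner_eq0.
  rewrite size_mul //; move: ab0; rewrite -size_poly_gt0.
  by move: (size (a * b)) (size A) => m n; lia.
right; right; split; last by rewrite BE b0 !mulr0.
by rewrite b0 dE mulrN1; case: a2 => ->; [left|right];
  rewrite ?opp_mx2 ?oppr0 ?opprK.
Qed.

(** * Automorphisms when |A| = |C| *)

(** Here [lam] enters only as the inverse of the leading coefficient of C. The last equation, which
    fixes [be] up to sign, serves the existence criterion and the count. *)
Lemma isAut_eq A B C (lam : F) (M : 'M[{poly F}]_2) :
  primitive_form A B C -> (1 < size (disc A B C))%N ->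
  (size B < size A)%N -> size A = size C ->
  imaginary (disc A B C) \/ unusual (disc A B C) ->
  lead_coef A = 1 -> lam * lead_coef C = 1 ->
  isAut A B C M ->
  exists u al be : F,
    [/\ u = 1 \/ u = -1, \det M = u%:P,
        M = mx2 al%:P be%:P (- u * lam * be)%:P (u * al)%:P &
        be != 0 -> [/\ u = -1, B != 0 & exists c : F,
          [/\ C * lam%:P - A = c%:P * B, al = - be * c &
              be ^+ 2 * (c ^+ 2 + lam) = 1]]].
Proof.
move=> prim sD sBA sAC anis lA lC; rewrite (mx2_eta M) det_mx2.
move: (M ord0 ord0) (M ord0 ord_max) (M ord_max ord0) (M ord_max ord_max).
move=> a b c d autM.
have sAC' : (size A <= size C)%N by rewrite sAC.
have A0 : A != 0 by rewrite -size_poly_gt0; lia.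
have C0 : C != 0 by rewrite -size_poly_gt0; lia.
have D0 : disc A B C != 0 by rewrite -size_poly_gt0; lia.
have [sa sd sc sb] := isAut_entries_size sBA sAC' anis autM.
rewrite {1}sAC in sc; rewrite -sAC in sb.
have {}sc := size_factor_sqr_le1 C0 sc; have {}sb := size_factor_sqr_le1 A0 sb.
have := isAut_det D0 autM.
case/isAut_mx2: autM => _.
rewrite (size1_polyC sa) (size1_polyC sb) (size1_polyC sc) (size1_polyC sd).
move: a`_0 b`_0 c`_0 d`_0 => {sa sb sc sd} {}a {}b {}c {}d eA eB eC det1.
have [u [u1 uE]] : exists u : F, (u = 1 \/ u = -1) /\ u = a * d - b * c.
  exists (a * d - b * c); split => //; move: det1.
  rewrite -!polyCM -polyCB -(polyC1 F) -polyCN.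
  by case=> /polyC_inj ->; [left|right].
have uu : u * u = 1 by case: u1 => ->; ring.
have An : A`_((size A).-1) = 1 by [].
have sB1 : (size B <= (size A).-1)%N by lia.
have Bn : B`_((size A).-1) = 0 by rewrite nth_default.
move: lC; have : C`_((size A).-1) = lead_coef C by rewrite sAC.
move: (lead_coef C) => l Cn laml.
have l0 : l != 0 by apply: contra_eq_neq laml => ->; rewrite mulr0 eq_sym oner_neq0.
pose lcE := (coefD, coefMC, An, Bn, Cn).
(* Coefficients in the common degree of A and C, to which B contributes nothing. *)
have e1 : a ^+ 2 + l * c ^+ 2 = 1.
  have /(congr1 (fun p : {poly F} => p`_((size A).-1))) := eA.
  rewrite -!polyC_exp !lcE => <-; ring.
have e2 : a * b + l * (c * d) = 0.
  have /(congr1 (fun p : {poly F} => p`_((size A).-1))) := eB.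
  rewrite -!polyC_natr -!polyCM -!polyCD.
  have -> : (2%:R)%:P * A * a%:P * b%:P + B * (a * d + b * c)%:P
    + (2%:R)%:P * C * c%:P * d%:P =
    A * (2%:R * a * b)%:P + B * (a * d + b * c)%:P + C * (2%:R * c * d)%:P.
    by ring.
  rewrite !lcE => e; apply: (mulfI two_neq0); rewrite mulr0 -e; ring.
have e3 : b ^+ 2 + l * d ^+ 2 = l.
  have /(congr1 (fun p : {poly F} => p`_((size A).-1))) := eC.
  rewrite -!polyC_exp !lcE => {2}<-; ring.
(* With G = diag(1, l), the isometry equations give G M = u adj(M)^T G; its first row yields [aE]
   and [cE]. *)
have aE : a = u * d.
  apply: (mulfI l0); rewrite uE.
  have -> : l * ((a * d - b * c) * d) = a * (l * d ^+ 2) - b * (l * (c * d)) by ring.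
  have -> : l * d ^+ 2 = l - b ^+ 2 by rewrite -{2}e3; ring.
  have -> : l * (c * d) = - (a * b) by apply/eqP; rewrite -addr_eq0 addrC e2.
  by ring.
have cE : c = - u * lam * b.
  apply: (mulfI l0).
  have -> : l * (- u * lam * b) = (lam * l) * (- u * b) by ring.
  rewrite laml mul1r uE.
  have -> : - (a * d - b * c) * b = - d * (a * b) + b ^+ 2 * c by ring.
  have -> : a * b = - (l * (c * d)) by apply/eqP; rewrite -addr_eq0 e2.
  have -> : b ^+ 2 = l - l * d ^+ 2 by rewrite -{1}e3; ring.
  by ring.
have dE : d = u * a by rewrite aE mulrA uu mul1r.
exists u, a, b; split => //; first by rewrite uE; ring.
  by rewrite -cE -dE.
move=> b0.
have lam0 : lam != 0.
  by apply: contra_eq_neq laml => ->; rewrite mul0r eq_sym oner_neq0.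
have two0 : (2%:R : {poly F}) != 0 by rewrite -polyC_natr polyC_eq0.
(* The first row of [adj(M)^T (M^T G M) = det M * G M], where [G] is twice the
   Gram matrix of the form; [isAut] replaces [M^T G M] by [G]. *)
have uP : u%:P = a%:P * d%:P - b%:P * c%:P by rewrite uE; ring.
have uuP : u%:P * u%:P = 1 :> {poly F} by rewrite -polyCM uu.
have row1 : u%:P * (2%:R * d%:P * A - c%:P * B) = 2%:R * A * a%:P + B * c%:P.
  transitivity (u%:P * u%:P * (2%:R * A * a%:P + B * c%:P)).
    by rewrite -[in LHS]eA -[X in _ - _ * X]eB uP; ring.
  by rewrite uuP mul1r.
have row2 : u%:P * (d%:P * B - 2%:R * c%:P * C) = 2%:R * A * b%:P + B * d%:P.
  transitivity (u%:P * u%:P * (2%:R * A * b%:P + B * d%:P)).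
    by rewrite -[in LHS]eC -[X in _ * X - _]eB uP; ring.
  by rewrite uuP mul1r.
(* Substituting the second row of M, [row1] will force u = -1 and [row2] the proportionality of C
   lam - A to B. *)
have uB : ((1 + u) * u * lam * b)%:P * B = 0.
  apply: oppr_inj; rewrite oppr0.
  have <- : 2%:R * A * a%:P + B * c%:P - u%:P * (2%:R * d%:P * A - c%:P * B) =
    - (((1 + u) * u * lam * b)%:P * B).
    by rewrite cE dE; ring: uuP.
  by rewrite row1 subrr.
have lamCA : (2%:R * b)%:P * (C * lam%:P - A) = ((u - 1) * a)%:P * B.
  apply/eqP; rewrite -subr_eq0; apply/eqP.
  by rewrite -(subrr (2%:R * A * b%:P + B * d%:P)) -{1}row2 cE dE; ring: uuP.
(* If B = 0, then A = lam C; primitivity makes A and C constant, and D with them. *)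
have B0 : B != 0.
  apply/eqP => B0; move/eqP: lamCA; rewrite B0 mulr0 mulf_eq0 polyC_eq0.
  rewrite mulf_eq0 (negPf two_neq0) (negPf b0) /= subr_eq0 => /eqP AE.
  have A1 : size A = 1%N.
    move: prim; rewrite /primitive_form B0 gcdp0 -AE mulrC mul_polyC.
    by rewrite coprimepZl // coprimepp size_scale // => /eqP.
  by case: (size_lead_disc sBA sAC') => sD' _; move: sD; rewrite sD' -sAC A1.
have u1' : u = -1.
  move/eqP: uB; rewrite mulf_eq0 (negPf B0) orbF polyC_eq0 !mulf_eq0.
  rewrite (negPf b0) (negPf lam0) !orbF.
  case: u1 => -> // /orP[]; last by rewrite oner_eq0.
  by rewrite -(natrD _ 1 1) (negPf two_neq0).
(* At u = -1, [lamCA] reads b (C lam - A) = - a B. *)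
split=> //; exists (- a / b); split.
- apply: (mulfI (_ : (2%:R * b)%:P != 0)).
    by rewrite polyC_eq0 mulf_neq0.
  rewrite lamCA u1' mulrA -polyCM; congr (_%:P * B); by field.
- by field.
by rewrite -e1 cE u1'; field: laml.
Qed.

(* The automorphisms with nonzero upper right entry [be]: necessarily [u = -1]
   and [al = - be * c], where [C lam - A = c B]. *)
Definition beta_aut (lam c be : F) : 'M[{poly F}]_2 :=
  mx2 (- be * c)%:P be%:P (lam * be)%:P (be * c)%:P.

Lemma mx_beta_aut lam c be : mx_beta (beta_aut lam c be) = be%:P.
Proof. by rewrite /mx_beta mxE. Qed.

(** The second hypothesis says that the determinant is -1; replacing C lam by c B + A turns each
    coefficient identity into a multiple of it. *)
Lemma isAut_beta_aut A B C (lam c be : F) :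
  C * lam%:P - A = c%:P * B -> be ^+ 2 * (c ^+ 2 + lam) = 1 ->
  isAut A B C (beta_aut lam c be).
Proof.
move=> /eqP; rewrite subr_eq => /eqP lamC bec.
have becP : be%:P ^+ 2 * (c%:P ^+ 2 + lam%:P) = 1 :> {poly F}.
  by rewrite -polyC1 -bec; ring.
apply/isAut_mx2; split.
- rewrite (_ : _ - _ = - (be%:P ^+ 2 * (c%:P ^+ 2 + lam%:P))); last by ring.
  by rewrite becP unitrN1.
- transitivity (A * (be%:P ^+ 2 * c%:P ^+ 2) - B * be%:P ^+ 2 * c%:P * lam%:P
      + (C * lam%:P) * (be%:P ^+ 2 * lam%:P)); first by ring.
  by rewrite lamC -[RHS]mulr1 -[in RHS]becP; ring.
- transitivity (- (2%:R * A * c%:P * be%:P ^+ 2)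
      + B * be%:P ^+ 2 * (lam%:P - c%:P ^+ 2)
      + 2%:R * be%:P ^+ 2 * c%:P * (C * lam%:P)); first by ring.
  by rewrite lamC -[RHS]mulr1 -[in RHS]becP; ring.
transitivity (be%:P ^+ 2 * (c%:P * B + A) + C * be%:P ^+ 2 * c%:P ^+ 2).
  by ring.
by rewrite -lamC -[RHS]mulr1 -[in RHS]becP; ring.
Qed.

Lemma isAut_betaP A B C (lam : F) (N : 'M[{poly F}]_2) :
  primitive_form A B C -> (1 < size (disc A B C))%N ->
  (size B < size A)%N -> size A = size C ->
  imaginary (disc A B C) \/ unusual (disc A B C) ->
  lead_coef A = 1 -> lam * lead_coef C = 1 ->
  isAut A B C N -> mx_beta N != 0 ->
  B != 0 /\ exists c be : F,
    [/\ C * lam%:P - A = c%:P * B, be ^+ 2 * (c ^+ 2 + lam) = 1 &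
        N = beta_aut lam c be].
Proof.
move=> prim sD sBA sAC anis lA lC autN.
have [u [al [be [_ _ ->]]]] := isAut_eq prim sD sBA sAC anis lA lC autN.
rewrite /mx_beta mxE /= polyC_eq0 => be_case /be_case[-> B0 [c [cE -> bec]]].
split=> //; exists c, be; split=> //.
by rewrite /beta_aut; congr mx2; congr (_%:P); ring.
Qed.

End Forms.

(** * The value of [lam], the existence criterion and the count *)

Theorem mainTheorem7 (F : finFieldType) (h : F) (A B C : {poly F})
  (M : 'M[{poly F}]_2) :
  coprime #|F| 6 ->
  primitive_root h ->
  standing h A B C ->
  (imaginary (disc A B C) \/ unusual (disc A B C)) ->
  partially_reduced h A B C ->
  isAut A B C M ->
  let lam : F := - 4%:R / h in
  ((size A < size C)%N ->
     M = 1%:M \/ M = - 1%:M \/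
     ((M = mx2 1 0 0 (-1) \/ M = - mx2 1 0 0 (-1)) /\ B = 0))
  /\
  (size A = size C ->
     (exists u al be : F,
        [/\ u = 1 \/ u = -1, \det M = u%:P,
            M = mx2 al%:P be%:P (- u * lam * be)%:P (u * al)%:P &
            (be != 0 ->
               B != 0 /\
               exists c : F, C * lam%:P - A = c%:P * B /\ al = u * be * c)])
     /\
     ((exists N : 'M[{poly F}]_2, isAut A B C N /\ mx_beta N != 0) <->
        (B != 0 /\ exists c : F, C * lam%:P - A = c%:P * B /\
                                  is_square_nz (c ^+ 2 + lam)))
     /\
     ((exists N : 'M[{poly F}]_2, isAut A B C N /\ mx_beta N != 0) ->
        exists N1 N2 : 'M[{poly F}]_2,
          [/\ N1 != N2, isAut A B C N1 /\ mx_beta N1 != 0,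
              isAut A B C N2 /\ mx_beta N2 != 0 &
              forall N, isAut A B C N -> mx_beta N != 0 -> N = N1 \/ N = N2])).
Proof.
move=> co prim_h [prim _ sD lD] anis [sBA sAC lA_lt lA_eq _] autM lam.
have two0 := natr2_neq0_of_coprime F co.
split=> [sACs|sACe]; first exact: (isAut_lt two0 sBA sACs anis autM).
have {lA_lt lA_eq} lA := lA_eq sACe.
(* Even degree makes sgn(D) = -4 sgn(C) a non-square, so it is h and not 1. *)
have lC : lam * lead_coef C = 1.
  have [_ lDE] := size_lead_disc two0 sBA sAC.
  have h0 : h != 0 by case: prim_h.
  case: (disc_anisotropic two0 sBA sAC anis) => [|].
    by rewrite sACe addnn odd_double.
  rewrite -lDE; case: lD => [->|lDh _].
    by case; exists 1; rewrite oner_neq0 expr1n.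
  move: lDE; rewrite lDh lA /lam mulr1 => hE.
  by apply: (mulfI h0); rewrite [RHS]mulr1 {3}hE; field.
have autP := isAut_betaP two0 prim sD sBA sACe anis lA lC.
split; last split.
- have [u [al [be [u1 detM ME be_case]]]] :=
    isAut_eq two0 prim sD sBA sACe anis lA lC autM.
  exists u, al, be; split=> // /be_case[-> B0 [c [cE alE _]]].
  split=> //; exists c; split=> //; by rewrite alE mulN1r.
- split=> [[N [autN betaN]]|[B0 [c [cE [y [y0 yE]]]]]].
    have [B0 [c [be [cE bec NE]]]] := autP N autN betaN.
    have be0 : be != 0.
      by apply: contra_eq_neq bec => ->; rewrite expr0n mul0r eq_sym oner_neq0.
    (* Since be^2 (c^2 + lam) = 1, square roots of c^2 + lam and admissible [be] are mutually
       inverse. *)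
    split=> //; exists c; split=> //; exists be^-1.
    rewrite invr_eq0 be0; split=> //.
    by apply: (mulfI (expf_neq0 2 be0)); rewrite bec; field.
  exists (beta_aut lam c y^-1).
  rewrite mx_beta_aut polyC_eq0 invr_eq0; split=> //.
  by apply: isAut_beta_aut => //; rewrite yE; field.
move=> [N [autN betaN]].
have [B0 [c [be [cE bec NE]]]] := autP N autN betaN.
have be0 : be != 0.
  by move: betaN; rewrite NE mx_beta_aut polyC_eq0.
exists (beta_aut lam c be), (beta_aut lam c (- be)).
rewrite !mx_beta_aut !polyC_eq0 oppr_eq0; split.
- apply/eqP => /(congr1 (@mx_beta _)); rewrite !mx_beta_aut => /polyC_inj beN.
  by move: be0; rewrite (eq_opp0 F be two0 beN) eqxx.
- by split=> //; apply: isAut_beta_aut.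
- by split=> //; apply: isAut_beta_aut => //; rewrite sqrrN.
move=> N' autN' betaN'.
have [_ [c' [be' [cE' bec' ->]]]] := autP N' autN' betaN'.
(* As B is nonzero, c is unique, so be^2 is determined and only the sign of [be] is free. *)
have cc : c' = c by apply/polyC_inj/(mulIf B0); rewrite -cE -cE'.
rewrite {}cc in bec' *.
have : be' ^+ 2 == be ^+ 2.
  apply/eqP; apply: (mulIf (_ : c ^+ 2 + lam != 0)); last by rewrite bec bec'.
  by apply: contra_eq_neq bec => ->; rewrite mulr0 eq_sym oner_neq0.
by rewrite eqf_sqr => /orP[]/eqP ->; [left|right].
Qed.
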